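(* Let $\frac12\le\theta\le1$, $\Delta t>0$, and let $(u_h^n,q_h^n)\in Q_h\times Q_h$, $n\ge0$, satisfy the fully discrete DG scheme $$\Big(\frac{u_h^{n+1}-u_h^n}{\Delta t},\phi\Big)=-A(q_h^{n+\theta},\phi),\qquad (q_h^n,\psi)=A(u_h^n,\psi)\qquad\text{for all }\phi,\psi\in Q_h,$$ where $v^{n+\theta}=(1-\theta)v^n+\theta v^{n+1}$. Then the scheme is unconditionally $L^2$ stable; moreover, for any $\Delta t>0$, $$\|u_h^{n+1}\|^2\le\|u_h^n\|^2-2\Delta t\,\|(1-\theta)q_h^n+\theta q_h^{n+1}\|^2 .$$
   Context: The scheme approximates $u_t=-(\partial_x^2+\partial_y^2)^2u$ on a rectangle $\Omega\subset\mathbb{R}^2$ with periodic boundary conditions. $\Omega$ is partitioned into rectangular cells $I_{i,j}=[x_{i-1/2},x_{i+1/2}]\times[y_{j-1/2},y_{j+1/2}]$, $1\le i\le N$, $1\le j\le M$, uniform with sizes $\Delta x=x_{i+1/2}-x_{i-1/2}$, $\Delta y=y_{j+1/2}-y_{j-1/2}$. $Q_h=\{v\in L^2(\Omega): v|_{I_{i,j}}\in Q^k(I_{i,j})\}$, where $Q^k$ denotes tensor-product polynomials of degree at most $k$ in each variable. On a vertical interface $x=x_{i+1/2}$: $\{v\}=\frac12(v(x_{i+1/2}^-,y)+v(x_{i+1/2}^+,y))$, $[v]=v(x_{i+1/2}^+,y)-v(x_{i+1/2}^-,y)$, and analogously on horizontal interfaces $y=y_{j+1/2}$; traces from outside $\Omega$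 on the boundary are taken by periodicity. $(\cdot,\cdot)$ and $\|\cdot\|$ are the $L^2(\Omega)$ inner product and norm. The bilinear form is $$A(w,v)=\sum_{i,j=1}^{N,M}\iint_{I_{i,j}}\nabla w\cdot\nabla v\,dxdy+\sum_{i,j=1}^{N,M}\int_{y_{j-1/2}}^{y_{j+1/2}}\big(\{w_x\}[v]+\{v_x\}[w]\big)_{x_{i+1/2}}dy+\sum_{i,j=1}^{N,M}\int_{x_{i-1/2}}^{x_{i+1/2}}\big(\{w_y\}[v]+\{v_y\}[w]\big)_{y_{j+1/2}}dx .$$ *)

(* Defs.v *)
From HB Require Import structures.
From mathcomp Require Import all_boot all_order all_algebra.
From mathcomp Require Import all_classical all_reals all_analysis.

Set Implicit Arguments.
Unset Strict Implicit.
Unset Printing Implicit Defensive.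

Import Order.TTheory GRing.Theory Num.Theory.
Import numFieldNormedType.Exports.

Local Open Scope classical_set_scope.
Local Open Scope ring_scope.

(* The rectangle [xmin, xmax] x [ymin, ymax], cut uniformly into ncellx * ncelly
   rectangular cells. *)
Record mesh (R : realType) := Mesh {
  xmin : R; xmax : R; ymin : R; ymax : R;
  ncellx : nat; ncelly : nat;
  lt_xmin_xmax : xmin < xmax;
  lt_ymin_ymax : ymin < ymax;
  ncellx_gt0 : (0 < ncellx)%N;
  ncelly_gt0 : (0 < ncelly)%N }.

Section DG.
Variables (R : realType) (m : mesh R).

Implicit Types v w : R * R -> R.

Local Notation mu := (@lebesgue_measure R).
Local Notation mu2 := (mu \x mu)%E.
Local Notation N := (ncellx m).
Local Notation M := (ncelly m).

Definition dx : R := (xmax m - xmin m) / N%:R.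
Definition dy : R := (ymax m - ymin m) / M%:R.

(* xnode i and ynode j are x_{i+1/2} and y_{j+1/2}, for 0 <= i <= N and
   0 <= j <= M. *)
Definition xnode (i : nat) : R := xmin m + dx *+ i.
Definition ynode (j : nat) : R := ymin m + dy *+ j.

Definition Omega : set (R * R) :=
  `[xmin m, xmax m]%classic `*` `[ymin m, ymax m]%classic.

(* The sides of the cells carry index i.-1, i for 1 <= i <= N (and likewise
   in y).  They are taken open: this changes no integral, and an element of
   L^2(Omega) does not see its values on the null set of cell edges. *)
Definition xside (i : nat) : set R := `]xnode i.-1, xnode i[%classic.
Definition yside (j : nat) : set R := `]ynode j.-1, ynode j[%classic.
Definition cell (i j : nat) : set (R * R) := xside i `*` yside j.

(* L^2(Omega) is encoded through the extension by 0 outside Omega (v \_ Omega);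
   functions are representatives, whose values outside Omega are irrelevant. *)
Definition L2inner v w : R := \int[mu2]_(z in Omega) (v z * w z).

Definition L2norm v : R := fine ('N[mu2]_2%:E[EFin \o (v \_ Omega)])%E.

Definition inL2 v : Prop := (v \_ Omega) \in Lfun mu2 2%:E.

Definition Qpoly (k : nat) (c : 'M[R]_k.+1) (z : R * R) : R :=
  \sum_(a < k.+1) \sum_(b < k.+1) c a b * z.1 ^+ a * z.2 ^+ b.

Definition Qh (k : nat) : set (R * R -> R) :=
  [set v | inL2 v /\
    forall i j : nat, (1 <= i <= N)%N -> (1 <= j <= M)%N ->
      exists c : 'M[R]_k.+1, forall z, cell i j z -> v z = Qpoly c z].

(* Only used inside cells and in the one-sided limits at interfaces, i.e. the
   gradient is the cellwise one. *)
Definition partialx v (z : R * R) : R := derive1 (fun s => v (s, z.2)) z.1.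
Definition partialy v (z : R * R) : R := derive1 (fun t => v (z.1, t)) z.2.

(* Traces v(x_{i+1/2}^-, y) and v(x_{i+1/2}^+, y) for 1 <= i <= N.  On the last
   interface i = N the right trace comes from outside Omega, and by
   periodicity it is the one at x_{1/2}; hence the index i %% N. *)
Definition xtrl v (i : nat) (y : R) : R := lim (v (s, y) @[s --> (xnode i)^'-]).
Definition xtrr v (i : nat) (y : R) : R :=
  lim (v (s, y) @[s --> (xnode (i %% N))^'+]).
Definition ytrl v (j : nat) (x : R) : R := lim (v (x, t) @[t --> (ynode j)^'-]).
Definition ytrr v (j : nat) (x : R) : R :=
  lim (v (x, t) @[t --> (ynode (j %% M))^'+]).

Definition xavg v (i : nat) (y : R) : R := (xtrl v i y + xtrr v i y) / 2.
Definition xjump v (i : nat) (y : R) : R := xtrr v i y - xtrl v i y.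
Definition yavg v (j : nat) (x : R) : R := (ytrl v j x + ytrr v j x) / 2.
Definition yjump v (j : nat) (x : R) : R := ytrr v j x - ytrl v j x.

Definition A w v : R :=
  \sum_(1 <= i < N.+1) \sum_(1 <= j < M.+1)
    (\int[mu2]_(z in cell i j)
      (partialx w z * partialx v z + partialy w z * partialy v z))
  + \sum_(1 <= i < N.+1) \sum_(1 <= j < M.+1)
    (\int[mu]_(y in yside j)
      (xavg (partialx w) i y * xjump v i y
       + xavg (partialx v) i y * xjump w i y))
  + \sum_(1 <= i < N.+1) \sum_(1 <= j < M.+1)
    (\int[mu]_(x in xside i)
      (yavg (partialy w) j x * yjump v j x
       + yavg (partialy v) j x * yjump w j x)).

Definition theta_avg (theta : R) (v : nat -> R * R -> R) (n : nat) (z : R * R) : R :=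
  (1 - theta) * v n z + theta * v n.+1 z.

Definition fully_discrete_DG (k : nat) (theta dt : R)
    (u q : nat -> R * R -> R) : Prop :=
  [/\ forall n, Qh k (u n) /\ Qh k (q n),
      forall n phi, Qh k phi ->
        L2inner (fun z => (u n.+1 z - u n z) / dt) phi
        = - A (theta_avg theta q n) phi
    & forall n psi, Qh k psi -> L2inner (q n) psi = A (u n) psi].

End DG.

(* Main.v *)
(* Write U, P for the theta-averages of u^n, u^{n+1} and of q^n, q^{n+1}.
   Testing the first equation with U and the theta-averaged second one with P,
   the symmetry of A and its linearity in the first argument give
     |P|^2 = A(U, P) = A(P, U) = - (u^{n+1} - u^n, U) / dt,
   while 2 (u^{n+1} - u^n, U) is
     |u^{n+1}|^2 - |u^n|^2 + (2 theta - 1) |u^{n+1} - u^n|^2.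
   The linearity of A is where the piecewise polynomial structure matters: the
   one-sided traces exist, and all the integrands are bounded and measurable,
   so that sums can be taken out of derivatives, limits and integrals. *)
Require Import Defs.
From mathcomp Require Import all_boot all_order all_algebra.
From mathcomp Require Import all_classical all_reals all_analysis.
From mathcomp Require Import measurable_realfun ring lra.

Import Order.TTheory GRing.Theory Num.Theory.
Import numFieldNormedType.Exports.

Local Open Scope classical_set_scope.
Local Open Scope ring_scope.

Set Implicit Arguments.
Unset Strict Implicit.

(** * Bounded measurable functions and linearity of their integrals *)

Definition bddmeas {d} {T : measurableType d} {R : realType} (D : set T)
    (f : T -> R) : Prop :=
  measurable_fun D f /\ exists K, forall x, D x -> `|f x| <= K.

Lemma bddmeas_cst d (T : measurableType d) (R : realType) (D : set T) (c : R) :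
  bddmeas D (fun=> c).
Proof. by split; [exact: measurable_cst | exists `|c|]. Qed.

Lemma bddmeasD d (T : measurableType d) (R : realType) (D : set T)
    (f g : T -> R) :
  bddmeas D f -> bddmeas D g -> bddmeas D (fun x => f x + g x).
Proof.
move=> [mf [K fK]] [mg [L gL]]; split; first exact: measurable_funD.
exists (K + L) => x Dx.
by rewrite (le_trans (ler_normD _ _))// lerD ?fK ?gL.
Qed.

Lemma bddmeasM d (T : measurableType d) (R : realType) (D : set T)
    (f g : T -> R) :
  bddmeas D f -> bddmeas D g -> bddmeas D (fun x => f x * g x).
Proof.
move=> [mf [K fK]] [mg [L gL]]; split; first exact: measurable_funM.
by exists (K * L) => x Dx; rewrite normrM ler_pM ?fK ?gL.
Qed.

Lemma bddmeas_eq d (T : measurableType d) (R : realType) (D : set T)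
    (f g : T -> R) :
  (forall x, D x -> f x = g x) -> bddmeas D g -> bddmeas D f.
Proof.
move=> fg [mg [K gK]]; split.
  by apply: eq_measurable_fun mg => x /set_mem Dx; rewrite fg.
by exists K => x Dx; rewrite fg ?gK.
Qed.

Lemma bddmeas_itv (R : realType) (l r : R) : bddmeas `]l, r[%classic (fun y : R => y).
Proof.
split; first exact: measurable_id.
exists (`|l| + `|r|) => y /=; rewrite in_itv/= => /andP[ly yr].
rewrite ler_norml; have := ler_norm r; have := ler_norm (- l).
have := normr_ge0 l; have := normr_ge0 r; rewrite normrN; lra.
Qed.

Lemma bddmeas_integrable d (T : measurableType d) (R : realType)
    (mu : {measure set T -> \bar R}) (D : set T) (f : T -> R) :
  measurable D -> (mu D < +oo)%E -> bddmeas D f ->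
  mu.-integrable D (EFin \o f).
Proof.
move=> mD Dfin [mf [K fK]]; apply: measurable_bounded_integrable => //.
exists K; split; first exact: num_real.
by move=> M KM x Dx; exact: le_trans (fK x Dx) (ltW KM).
Qed.

(** The pointwise identity behind an interface integrand: [x], [y] are the averages and [x'], [y']
    the jumps of the two functions being combined, [c] and [d] the jump and the average of the fixed
    argument. *)
Lemma sum_prod_lin {R : comPzRingType} (a b c d x x' y y' : R) :
  (a * x + b * y) * c + d * (a * x' + b * y') =
  a * (x * c + d * x') + b * (y * c + d * y').
Proof. by ring. Qed.

(** The same for averages: [x], [y] are left traces, [x'], [y'] right traces, and [c] is one
    half. *)
Lemma sumM_lin {R : comPzRingType} (a b c x x' y y' : R) :
  (a * x + b * y + (a * x' + b * y')) * c =
  a * ((x + x') * c) + b * ((y + y') * c).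
Proof. by ring. Qed.

(** The pointwise equality is asked on [D] only, since derivatives and traces of a combination are
    known to split only inside the cells and over their open sides. *)
Lemma Rintegral_lin d (T : measurableType d) (R : realType)
    (mu : {measure set T -> \bar R}) (D : set T) (a b : R) (f g h : T -> R) :
  measurable D -> mu.-integrable D (EFin \o g) -> mu.-integrable D (EFin \o h) ->
  (forall x, D x -> f x = a * g x + b * h x) ->
  \int[mu]_(x in D) f x = a * \int[mu]_(x in D) g x + b * \int[mu]_(x in D) h x.
Proof.
move=> mD ig ih fE.
rewrite -!RintegralZl// -RintegralD//; last 2 first.
- exact: (integrableZl mD a ig).
- exact: (integrableZl mD b ih).
by apply: eq_Rintegral => x /set_mem Dx; rewrite fE.
Qed.

(** * Polynomial functions of two variables *)

Inductive polyfun {R : realType} : (R * R -> R) -> Prop :=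
| polyfun_cst c : polyfun (fun=> c)
| polyfun_fst : polyfun (fun z => z.1)
| polyfun_snd : polyfun (fun z => z.2)
| polyfunD f g : polyfun f -> polyfun g -> polyfun (fun z => f z + g z)
| polyfunM f g : polyfun f -> polyfun g -> polyfun (fun z => f z * g z).

(** The map [h] lets one statement serve both integrals: it is the identity on a cell, and the
    embedding of an open side into a vertical line for traces. *)
Lemma polyfun_bddmeas d (T : measurableType d) (R : realType) (D : set T)
    (g : R * R -> R) (h : T -> R * R) :
  bddmeas D (fun x => (h x).1) -> bddmeas D (fun x => (h x).2) ->
  polyfun g -> bddmeas D (g \o h).
Proof.
move=> h1 h2; elim=> [c|//|//|f1 g1 _ + _|f1 g1 _ + _].
- exact: bddmeas_cst.
- exact: bddmeasD.
- exact: bddmeasM.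
Qed.

(** Induction on the construction of [g], with the sum and product rules; [polyfun] is an inductive
    predicate without degree bound to make this possible. The derivative being polynomial again, it
    has traces and is bounded on cells. *)
Lemma polyfun_derivex {R : realType} (g : R * R -> R) : polyfun g ->
  exists2 g', polyfun g' &
    forall z : R * R, is_derive z.1 (1 : R) (fun s => g (s, z.2)) (g' z).
Proof.
elim=> [c|||f1 g1 pf [f' pf' df] pg [g' pg' dg]|f1 g1 pf [f' pf' df] pg [g' pg' dg]].
- by exists (fun=> 0); [exact: polyfun_cst|move=> z; exact: is_derive_cst].
- by exists (fun=> 1); [exact: polyfun_cst|move=> z; exact: is_derive_id].
- by exists (fun=> 0); [exact: polyfun_cst|move=> z; exact: is_derive_cst].
- exists (fun z => f' z + g' z); first exact: polyfunD.
  by move=> z; exact: is_deriveD.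
- exists (fun z => f1 z * g' z + g1 z * f' z).
    by apply: polyfunD; exact: polyfunM.
  move=> [x y]; have /= Df := df (x, y); have /= Dg := dg (x, y).
  exact: (is_deriveM Df Dg).
Qed.

Lemma polyfun_continuousx {R : realType} (g : R * R -> R) (x y : R) :
  polyfun g -> g (s, y) @[s --> x] --> g (x, y).
Proof.
move=> /polyfun_derivex[g' _ /(_ (x, y))/= [dg _]].
by have /derivable1_diffP/differentiable_continuous := dg.
Qed.

Lemma polyfun_swap {R : realType} (g : R * R -> R) :
  polyfun g -> polyfun (fun z => g (z.2, z.1)).
Proof.
elim=> [c|||f1 g1 _ pf _ pg|f1 g1 _ pf _ pg].
- exact: polyfun_cst.
- exact: polyfun_snd.
- exact: polyfun_fst.
- exact: polyfunD pf pg.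
- exact: polyfunM pf pg.
Qed.

Lemma polyfun_sum {R : realType} (n : nat) (F : 'I_n -> R * R -> R) :
  (forall i, polyfun (F i)) -> polyfun (fun z => \sum_(i < n) F i z).
Proof.
move=> pF; elim: n F pF => [|n IH] F pF.
  rewrite (_ : (fun _ => _) = fun=> 0); first exact: polyfun_cst.
  by apply/funext => z; rewrite big_ord0.
rewrite (_ : (fun _ => _) = fun z =>
    \sum_(i < n) F (widen_ord (leqnSn n) i) z + F ord_max z).
  by apply: polyfunD => //; exact: IH.
by apply/funext => z; rewrite big_ord_recr.
Qed.

Lemma polyfunX {R : realType} (f : R * R -> R) (n : nat) :
  polyfun f -> polyfun (fun z => f z ^+ n).
Proof.
move=> pf; elim: n => [|n IH]; first exact: polyfun_cst.
rewrite (_ : (fun _ => _) = fun z => f z * f z ^+ n); first exact: polyfunM.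
by apply/funext => z; rewrite exprS.
Qed.

Lemma polyfun_Qpoly {R : realType} (k : nat) (c : 'M[R]_k.+1) :
  polyfun (Qpoly c).
Proof.
apply: polyfun_sum => a; apply: polyfun_sum => b.
apply: polyfunM; last exact/polyfunX/polyfun_snd.
by apply: polyfunM; [exact: polyfun_cst | exact/polyfunX/polyfun_fst].
Qed.

Lemma restrictM {T : Type} {R : realType} (D : set T) (f g : T -> R) :
  (fun x => f x * g x) \_ D = (f \_ D) \* (g \_ D).
Proof. by apply/funext => x; rewrite /= !patchE; case: ifP => // _; rewrite mulr0. Qed.

Lemma restrict_lin {T : Type} {R : realType} (D : set T) (a b : R) (f g : T -> R) :
  (fun x => a * f x + b * g x) \_ D = a *: (f \_ D) + b *: (g \_ D).
Proof.
apply/funext => x; rewrite /= !fctE !patchE; case: ifP => // _.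
by rewrite !scaler0 addr0.
Qed.

(** * The inner product and the norm of L^2 of the rectangle *)

Section L2.
Variables (R : realType) (m : mesh R).
Implicit Types v w : R * R -> R.
Local Notation mu := (@lebesgue_measure R).
Local Notation mu2 := (mu \x mu)%E.

Lemma measurable_Omega : measurable (Omega m).
Proof. by apply: measurableX; exact: measurable_itv. Qed.

Lemma inL2_lin (a b : R) v w : inL2 m v -> inL2 m w ->
  inL2 m (fun z => a * v z + b * w z).
Proof.
rewrite /inL2 restrict_lin => v2 w2.
have [L0 LD] := Lfun_submod_closed mu2 (lee1n 2).
(* [LD] gives closure under [a *: f + g]; its second use, with [g = 0], handles [b *: w]. *)
by apply: (LD) => //; rewrite -[b *: _]addr0; exact: LD.
Qed.

(** A product of two L^2 functions is in L^1, and extension by zero commutes with products, which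
    brings integrability back to [Omega]. *)
Lemma L2_integrable v w : inL2 m v -> inL2 m w ->
  mu2.-integrable (Omega m) (EFin \o (fun z => v z * w z)).
Proof.
move=> v2 w2.
apply: (proj2 (integrable_mkcond (mu := mu2) (EFin \o (fun z => v z * w z))
  measurable_Omega)).
by rewrite restrict_EFin restrictM; apply/Lfun1_integrable; exact: Lfun2_mul_Lfun1.
Qed.

Lemma L2innerC v w : L2inner m v w = L2inner m w v.
Proof. by apply: eq_Rintegral => z _; rewrite mulrC. Qed.

Lemma L2inner_lin (a b : R) v w p : inL2 m v -> inL2 m w -> inL2 m p ->
  L2inner m (fun z => a * v z + b * w z) p =
  a * L2inner m v p + b * L2inner m w p.
Proof.
move=> v2 w2 p2; apply: Rintegral_lin; first exact: measurable_Omega.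
- exact: L2_integrable.
- exact: L2_integrable.
- by move=> z _; rewrite mulrDl !mulrA.
Qed.

Lemma L2norm_ge0 v : 0 <= L2norm m v.
Proof. by rewrite fine_ge0// Lnorm_ge0. Qed.

Lemma L2inner_ge0 v : 0 <= L2inner m v v.
Proof. by apply: Rintegral_ge0 => z _; rewrite -expr2 sqr_ge0. Qed.

Lemma sqr_L2norm v : inL2 m v -> L2norm m v ^+ 2 = L2inner m v v.
Proof.
move=> v2; rewrite -powR_mulrn ?L2norm_ge0// /L2norm /L2inner.
rewrite Rintegral_mkcond restrictM /Rintegral.
(* [fine] would send an infinite norm to 0; finiteness comes from [inL2]. *)
rewrite -[LHS]/(fine ((_ `^ 2)%:E)) -poweR_EFin fineK; last first.
  rewrite ge0_fin_numE ?Lnorm_ge0//.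
  by move: v2; rewrite /inL2 inE => /andP[_]; rewrite inE.
rewrite powR_Lnorm//; congr fine; apply: eq_integral => z _ /=.
by rewrite powR_mulrn// real_normK ?num_real// expr2.
Qed.

End L2.

(** * Piecewise polynomials: derivatives and traces in the [x] direction *)

Section cellwise.
Variables (R : realType) (m : mesh R).
Implicit Types v w : R * R -> R.

(** Weaker than [Qh]: neither degree nor integrability is recorded, so that a cell by cell argument
    suffices to show that partial derivatives stay in the class. *)
Definition cellwise v : Prop := forall i j,
  (1 <= i <= ncellx m)%N -> (1 <= j <= ncelly m)%N ->
  exists2 g, polyfun g & forall z, cell m i j z -> v z = g z.

Lemma Qh_cellwise k v : Qh m k v -> cellwise v.
Proof.
move=> [_ vQ] i j iN jM; have [c vc] := vQ i j iN jM.
by exists (Qpoly c); first exact: polyfun_Qpoly.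
Qed.

Lemma cellwise_lin (a b : R) v w : cellwise v -> cellwise w ->
  cellwise (fun z => a * v z + b * w z).
Proof.
move=> cv cw i j iN jM.
have [f pf vf] := cv i j iN jM; have [g pg wg] := cw i j iN jM.
exists (fun z => a * f z + b * g z).
  by apply: polyfunD; apply: polyfunM => //; exact: polyfun_cst.
by move=> z zc; rewrite vf ?wg.
Qed.

(** The sides are open intervals, so the derivative at a point of a cell is determined by the values
    inside that cell. *)
Lemma near_cellx i j (z : R * R) : cell m i j z ->
  \forall s \near z.1, cell m i j (s, z.2).
Proof.
move=> [z1 z2]; have : \forall s \near z.1, s \in `]xnode m i.-1, xnode m i[.
  exact: near_in_itvoo.
by apply: filterS => s.
Qed.

Lemma partialx_cell i j v (g : R * R -> R) (z : R * R) (l : R) :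
  (forall z, cell m i j z -> v z = g z) -> cell m i j z ->
  is_derive z.1 (1 : R) (fun s => g (s, z.2)) l -> partialx v z = l.
Proof.
move=> vg zc [_ <-]; rewrite /partialx derive1E.
by apply: near_eq_derive; apply: filterS (near_cellx zc) => s /vg.
Qed.

Lemma cellwise_partialx v : cellwise v -> cellwise (partialx v).
Proof.
move=> cv i j iN jM; have [g pg vg] := cv i j iN jM.
have [g' pg' dg] := polyfun_derivex pg.
by exists g' => // z zc; exact: (partialx_cell vg zc).
Qed.

Lemma partialx_lin (a b : R) v w i j (z : R * R) :
  (1 <= i <= ncellx m)%N -> (1 <= j <= ncelly m)%N ->
  cellwise v -> cellwise w -> cell m i j z ->
  partialx (fun z => a * v z + b * w z) z = a * partialx v z + b * partialx w z.
Proof.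
move=> iN jM cv cw zc.
have [f pf vf] := cv i j iN jM; have [g pg wg] := cw i j iN jM.
have [f' pf' /(_ z) df] := polyfun_derivex pf.
have [g' pg' /(_ z) dg] := polyfun_derivex pg.
rewrite (partialx_cell vf zc df) (partialx_cell wg zc dg).
apply: (partialx_cell (g := fun z => a * f z + b * g z) _ zc).
by move=> y yc; rewrite vf ?wg.
Qed.

Lemma dx_gt0 : 0 < dx m.
Proof. by rewrite divr_gt0 ?subr_gt0 ?lt_xmin_xmax// ltr0n ncellx_gt0. Qed.

Lemma ltr_xnode i : xnode m i < xnode m i.+1.
Proof. by rewrite /xnode ltrD2l ltr_pMn2l ?dx_gt0. Qed.

Lemma near_xtrl i j y : (1 <= i)%N -> yside m j y ->
  \forall s \near (xnode m i)^'-, cell m i j (s, y).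
Proof.
case: i => // i _ yj; near=> s; split => //=; rewrite /xside/= in_itv/=.
apply/andP; split; near: s; first by apply: nbhs_left_gt; exact: ltr_xnode.
exact: nbhs_left_lt.
Unshelve. all: by end_near. Qed.

Lemma near_xtrr i j y : yside m j y ->
  \forall s \near (xnode m i)^'+, cell m i.+1 j (s, y).
Proof.
move=> yj; near=> s; split => //=; rewrite /xside/= in_itv/=.
apply/andP; split; near: s; first exact: nbhs_right_gt.
by apply: nbhs_right_lt; exact: ltr_xnode.
Unshelve. all: by end_near. Qed.

(** Just left of the interface [v] coincides with the polynomial of the adjacent cell, and that
    polynomial is continuous. *)
Lemma xtrlE v (g : R * R -> R) i j y : (1 <= i)%N -> polyfun g ->
  (forall z, cell m i j z -> v z = g z) -> yside m j y ->
  xtrl m v i y = g (xnode m i, y).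
Proof.
move=> i0 pg vg yj; apply: cvg_lim => //.
apply: (cvg_trans (near_eq_cvg (F := (xnode m i)^'-) (f := fun s => g (s, y)) _)).
  by apply: filterS (near_xtrl i0 yj) => s /vg ->.
by apply: cvg_at_left_filter; exact: polyfun_continuousx.
Qed.

(** The index [(i %% ncellx m).+1] covers both cases: it is [i.+1] at an inner interface, and 1 at
    the last one, where periodicity leads back to the first cell. *)
Lemma xtrrE v (g : R * R -> R) i j y : polyfun g ->
  (forall z, cell m (i %% ncellx m).+1 j z -> v z = g z) -> yside m j y ->
  xtrr m v i y = g (xnode m (i %% ncellx m), y).
Proof.
move=> pg vg yj; apply: cvg_lim => //.
apply: (cvg_trans (near_eq_cvg (F := (xnode m (i %% ncellx m))^'+)
  (f := fun s => g (s, y)) _)).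
  by apply: filterS (near_xtrr (i %% ncellx m) yj) => s /vg ->.
by apply: cvg_at_right_filter; exact: polyfun_continuousx.
Qed.

Lemma xtrr_cell_bound i : (1 <= (i %% ncellx m).+1 <= ncellx m)%N.
Proof. by rewrite ltn_mod ncellx_gt0. Qed.

Section interface.
Variables i j : nat.
Hypotheses (iN : (1 <= i <= ncellx m)%N) (jM : (1 <= j <= ncelly m)%N).

(** Serves [xavg_partialx_lin]: the linearity of [partialx] is an equality inside cells, and a trace
    sees no more than those values. *)
Lemma xtrl_ext v w y : cellwise w -> yside m j y ->
  (forall z, cell m i j z -> v z = w z) -> xtrl m v i y = xtrl m w i y.
Proof.
move=> cw yj vw; have [g pg wg] := cw i j iN jM; have /andP[i0 _] := iN.
rewrite !(xtrlE (g := g) (j := j))//.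
by move=> z zc; rewrite vw ?wg.
Qed.

Lemma xtrr_ext v w y : cellwise w -> yside m j y ->
  (forall z, cell m (i %% ncellx m).+1 j z -> v z = w z) ->
  xtrr m v i y = xtrr m w i y.
Proof.
move=> cw yj vw; have [g pg wg] := cw _ j (xtrr_cell_bound i) jM.
rewrite !(xtrrE (g := g) (j := j))//.
by move=> z zc; rewrite vw ?wg.
Qed.

Lemma xtrl_lin (a b : R) v w y : cellwise v -> cellwise w -> yside m j y ->
  xtrl m (fun z => a * v z + b * w z) i y = a * xtrl m v i y + b * xtrl m w i y.
Proof.
move=> cv cw yj; have /andP[i0 _] := iN.
have [f pf vf] := cv i j iN jM; have [g pg wg] := cw i j iN jM.
rewrite (xtrlE i0 pf vf)// (xtrlE i0 pg wg)//.
rewrite (xtrlE (g := fun z => a * f z + b * g z) (j := j))//.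
- by apply: polyfunD; apply: polyfunM => //; exact: polyfun_cst.
- by move=> z zc; rewrite vf ?wg.
Qed.

Lemma xtrr_lin (a b : R) v w y : cellwise v -> cellwise w -> yside m j y ->
  xtrr m (fun z => a * v z + b * w z) i y = a * xtrr m v i y + b * xtrr m w i y.
Proof.
move=> cv cw yj.
have [f pf vf] := cv _ j (xtrr_cell_bound i) jM.
have [g pg wg] := cw _ j (xtrr_cell_bound i) jM.
rewrite (xtrrE pf vf)// (xtrrE pg wg)//.
rewrite (xtrrE (g := fun z => a * f z + b * g z) (j := j))//.
- by apply: polyfunD; apply: polyfunM => //; exact: polyfun_cst.
- by move=> z zc; rewrite vf ?wg.
Qed.

Lemma xjump_lin (a b : R) v w y : cellwise v -> cellwise w -> yside m j y ->
  xjump m (fun z => a * v z + b * w z) i y =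
  a * xjump m v i y + b * xjump m w i y.
Proof.
move=> cv cw yj; rewrite /xjump xtrl_lin// xtrr_lin//.
by rewrite opprD addrACA -!mulrBr.
Qed.

Lemma xavg_partialx_lin (a b : R) v w y :
  cellwise v -> cellwise w -> yside m j y ->
  xavg m (partialx (fun z => a * v z + b * w z)) i y =
  a * xavg m (partialx v) i y + b * xavg m (partialx w) i y.
Proof.
move=> cv cw yj; have cpv := cellwise_partialx cv.
have cpw := cellwise_partialx cw.
have cp := cellwise_lin a b cpv cpw.
rewrite /xavg (xtrl_ext cp)//; last first.
  by move=> z; exact: partialx_lin.
rewrite (xtrr_ext cp)//; last first.
  by move=> z; apply: partialx_lin => //; exact: xtrr_cell_bound.
rewrite xtrl_lin// xtrr_lin//; exact: sumM_lin.
Qed.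

(** By [xtrlE] the trace is a polynomial in [y], taken on a bounded interval. *)
Lemma bddmeas_xtrl v : cellwise v -> bddmeas (yside m j) (xtrl m v i).
Proof.
move=> cv; have [g pg vg] := cv i j iN jM; have /andP[i0 _] := iN.
apply: (bddmeas_eq (g := g \o (fun y => (xnode m i, y)))).
  by move=> y; exact: xtrlE.
apply: polyfun_bddmeas pg; first exact: bddmeas_cst.
exact: bddmeas_itv.
Qed.

Lemma bddmeas_xtrr v : cellwise v -> bddmeas (yside m j) (xtrr m v i).
Proof.
move=> cv; have [g pg vg] := cv _ j (xtrr_cell_bound i) jM.
apply: (bddmeas_eq (g := g \o (fun y => (xnode m (i %% ncellx m), y)))).
  by move=> y; exact: xtrrE.
apply: polyfun_bddmeas pg; first exact: bddmeas_cst.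
exact: bddmeas_itv.
Qed.

Lemma bddmeas_xavg v : cellwise v -> bddmeas (yside m j) (xavg m v i).
Proof.
move=> cv; apply: bddmeasM; last exact: bddmeas_cst.
by apply: bddmeasD; [exact: bddmeas_xtrl|exact: bddmeas_xtrr].
Qed.

Lemma bddmeas_xjump v : cellwise v -> bddmeas (yside m j) (xjump m v i).
Proof.
move=> cv; rewrite (_ : xjump m v i = fun y => xtrr m v i y + -1 * xtrl m v i y).
  apply: bddmeasD; first exact: bddmeas_xtrr.
  by apply: bddmeasM; [exact: bddmeas_cst|exact: bddmeas_xtrl].
by apply/funext => y; rewrite mulN1r.
Qed.

(** Averages and jumps are bounded and measurable on a side of finite length, so each summand is
    integrable and the integral splits. *)
Lemma xinterface_lin (a b : R) v w p :
  cellwise v -> cellwise w -> cellwise p ->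
  let F v := \int[@lebesgue_measure R]_(y in yside m j)
    (xavg m (partialx v) i y * xjump m p i y +
     xavg m (partialx p) i y * xjump m v i y) in
  F (fun z => a * v z + b * w z) = a * F v + b * F w.
Proof.
move=> cv cw cp /=.
have my : measurable (yside m j) by exact: measurable_itv.
have yfin : (@lebesgue_measure R (yside m j) < +oo)%E.
  by rewrite /yside lebesgue_measure_itv; case: ifP => //= _; rewrite -EFinD ltry.
have I v' : cellwise v' -> (@lebesgue_measure R).-integrable (yside m j)
    (EFin \o (fun y => xavg m (partialx v') i y * xjump m p i y +
     xavg m (partialx p) i y * xjump m v' i y)).
  move=> cv'; apply: bddmeas_integrable => //.
  apply: bddmeasD; apply: bddmeasM;
    by [apply: bddmeas_xavg; exact: cellwise_partialx|exact: bddmeas_xjump].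
apply: Rintegral_lin => //; [exact: I|exact: I|].
move=> y yj; rewrite xavg_partialx_lin// xjump_lin//.
exact: sum_prod_lin.
Qed.

End interface.
End cellwise.

(* Exchanging the two axes reduces every statement about y to one about x. *)
Definition transpose {R : realType} (m : mesh R) : mesh R :=
  Mesh (lt_ymin_ymax m) (lt_xmin_xmax m) (ncelly_gt0 m) (ncellx_gt0 m).

Definition flip {R : realType} (v : R * R -> R) (z : R * R) : R := v (z.2, z.1).

Lemma cellwise_flip (R : realType) (m : mesh R) (v : R * R -> R) :
  cellwise m v -> cellwise (transpose m) (flip v).
Proof.
move=> cv i j iN jM; have [g pg vg] := cv j i jM iN.
exists (fun z => g (z.2, z.1)); first exact: polyfun_swap.
by move=> z [z1 z2]; apply: vg.
Qed.

(** [flip (partialx (flip v))] unfolds to [partialy v], and transposing the mesh twice restores its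
    cells. *)
Lemma cellwise_partialy (R : realType) (m : mesh R) (v : R * R -> R) :
  cellwise m v -> cellwise m (partialy v).
Proof.
move=> /cellwise_flip/cellwise_partialx/cellwise_flip cv i j iN jM.
have [g pg vg] := cv i j iN jM.
by exists g.
Qed.

Lemma partialy_lin (R : realType) (m : mesh R) (a b : R) (v w : R * R -> R)
    i j (z : R * R) :
  (1 <= i <= ncellx m)%N -> (1 <= j <= ncelly m)%N ->
  cellwise m v -> cellwise m w -> cell m i j z ->
  partialy (fun z => a * v z + b * w z) z = a * partialy v z + b * partialy w z.
Proof.
move=> iN jM /cellwise_flip cv /cellwise_flip cw [z1 z2].
exact: (partialx_lin a b (m := transpose m) (z := (z.2, z.1)) jM iN cv cw).
Qed.

Lemma yinterface_lin (R : realType) (m : mesh R) (i j : nat) (a b : R)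
    (v w p : R * R -> R) :
  (1 <= i <= ncellx m)%N -> (1 <= j <= ncelly m)%N ->
  cellwise m v -> cellwise m w -> cellwise m p ->
  let F v := \int[@lebesgue_measure R]_(x in xside m i)
    (yavg m (partialy v) j x * yjump m p j x +
     yavg m (partialy p) j x * yjump m v j x) in
  F (fun z => a * v z + b * w z) = a * F v + b * F w.
Proof.
move=> iN jM /cellwise_flip cv /cellwise_flip cw /cellwise_flip cp.
exact: (xinterface_lin (m := transpose m) jM iN a b cv cw cp).
Qed.

(** * Cell integrals, then symmetry and linearity of the form [A] *)

Lemma volume_lin (R : realType) (m : mesh R) (i j : nat) (a b : R)
    (v w p : R * R -> R) :
  (1 <= i <= ncellx m)%N -> (1 <= j <= ncelly m)%N ->
  cellwise m v -> cellwise m w -> cellwise m p ->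
  let F v := \int[(@lebesgue_measure R \x @lebesgue_measure R)%E]_(z in cell m i j)
    (partialx v z * partialx p z + partialy v z * partialy p z) in
  F (fun z => a * v z + b * w z) = a * F v + b * F w.
Proof.
move=> iN jM cv cw cp /=.
set mu := @lebesgue_measure R.
have side_fin (l r : R) : (mu `]l, r[%classic < +oo)%E.
  by rewrite /mu lebesgue_measure_itv; case: ifP => //= _; rewrite -EFinD ltry.
have mx : measurable (xside m i) by exact: measurable_itv.
have my : measurable (yside m j) by exact: measurable_itv.
have mc : measurable (cell m i j) by exact: measurableX.
(* The area of a cell is the product of two finite lengths. *)
have cfin : ((mu \x mu)%E (cell m i j) < +oo)%E.
  rewrite /cell product_measure1E//.
  have xfin := side_fin (xnode m i.-1) (xnode m i).
  by apply: lte_mul_pinfty; rewrite ?ge0_fin_numE//; exact: side_fin.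
(* Once both coordinates are bounded and measurable on the cell, so is every polynomial in them. *)
have B1 : bddmeas (cell m i j) (fun z : R * R => z.1).
  have [_ [K xK]] := bddmeas_itv (xnode m i.-1) (xnode m i).
  split; last by exists K => z [/xK].
  exact: (measurable_funTS measurable_fst).
have B2 : bddmeas (cell m i j) (fun z : R * R => z.2).
  have [_ [K xK]] := bddmeas_itv (ynode m j.-1) (ynode m j).
  split; last by exists K => z [_ /xK].
  exact: (measurable_funTS measurable_snd).
have B v' : cellwise m v' -> bddmeas (cell m i j) v'.
  move=> cv'; have [g pg vg] := cv' i j iN jM.
  apply: (bddmeas_eq (g := g \o id) vg).
  exact: (polyfun_bddmeas (h := id)).
have I v' : cellwise m v' -> (mu \x mu)%E.-integrable (cell m i j)
    (EFin \o (fun z => partialx v' z * partialx p z + partialy v' z * partialy p z)).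
  move=> cv'; apply: bddmeas_integrable => //.
  apply: bddmeasD; apply: bddmeasM; apply: B;
    by [exact: cellwise_partialx|exact: cellwise_partialy].
apply: Rintegral_lin => //; [exact: I|exact: I|].
move=> z zc; rewrite (partialx_lin a b (m := m) (i := i) (j := j))//.
by rewrite (partialy_lin a b (m := m) (i := i) (j := j))//; ring.
Qed.

(** Exchanging the arguments commutes the products in the cell integrals and swaps the two summands
    in each interface integrand. *)
Lemma AC (R : realType) (m : mesh R) (v w : R * R -> R) : A m v w = A m w v.
Proof.
rewrite /A; apply: f_equal2; first apply: f_equal2.
- apply: eq_bigr => i _; apply: eq_bigr => j _.
  apply: eq_Rintegral => z _.
  by rewrite [partialx v z * _]mulrC [partialy v z * _]mulrC.
- apply: eq_bigr => i _; apply: eq_bigr => j _.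
  by apply: eq_Rintegral => y _; exact: addrC.
- apply: eq_bigr => i _; apply: eq_bigr => j _.
  by apply: eq_Rintegral => x _; exact: addrC.
Qed.

Lemma A_lin (R : realType) (m : mesh R) (a b : R) (v w p : R * R -> R) :
  cellwise m v -> cellwise m w -> cellwise m p ->
  A m (fun z => a * v z + b * w z) p = a * A m v p + b * A m w p.
Proof.
move=> cv cw cp.
(* The three parts of [A] share this double sum, so one linearity argument serves them all. *)
pose cells (F : nat -> nat -> R) :=
  \sum_(1 <= i < (ncellx m).+1) \sum_(1 <= j < (ncelly m).+1) F i j.
have cells_lin F G H : (forall i j, (1 <= i <= ncellx m)%N ->
    (1 <= j <= ncelly m)%N -> F i j = a * G i j + b * H i j) ->
    cells F = a * cells G + b * cells H.
  move=> FGH; rewrite /cells !mulr_sumr -big_split/=.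
  rewrite big_nat [RHS]big_nat; apply: eq_bigr => i iN.
  rewrite !mulr_sumr -big_split/= big_nat [RHS]big_nat.
  by apply: eq_bigr => j jM; exact: FGH.
rewrite /A !mulrDr.
(* Pairs each of the three contributions of [v] with the matching one of [w]. *)
rewrite (addrACA (a * _ + a * _)) (addrACA (a * _)).
apply: f_equal2; first apply: f_equal2; apply: cells_lin => i j iN jM.
- exact: volume_lin.
- exact: xinterface_lin.
- exact: yinterface_lin.
Qed.

(** * The energy estimate and stability *)

Unset Implicit Arguments.
Set Strict Implicit.

Theorem theorem3p3 (R : realType) (m : mesh R) (k : nat) (theta dt : R)
    (htheta : 1 / 2 <= theta <= 1) (hdt : 0 < dt)
    (u q : nat -> R * R -> R)
    (huq : fully_discrete_DG m k theta dt u q) :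
  (forall n : nat, L2norm m (u n) <= L2norm m (u 0%N)) /\
  (forall n : nat,
     L2norm m (u n.+1) ^+ 2 <=
     L2norm m (u n) ^+ 2
     - 2 * dt * L2norm m (fun z => (1 - theta) * q n z + theta * q n.+1 z) ^+ 2).
Proof.
have [Q scheme_u scheme_q] := huq.
(* The theta-averages have to lie in [Qh] to be admissible test functions. *)
have Qlin a b v w : Qh m k v -> Qh m k w -> Qh m k (fun z => a * v z + b * w z).
  move=> [v2 vQ] [w2 wQ]; split; first exact: inL2_lin.
  move=> i j iN jM; have [c vc] := vQ i j iN jM; have [d wd] := wQ i j iN jM.
  exists (a *: c + b *: d) => z zc; rewrite vc// wd// /Qpoly !mulr_sumr -big_split/=.
  apply: eq_bigr => x _; rewrite !mulr_sumr -big_split/=.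
  by apply: eq_bigr => y _; rewrite !mxE; ring.
have step n : L2norm m (u n.+1) ^+ 2 <= L2norm m (u n) ^+ 2
     - 2 * dt * L2norm m (fun z => (1 - theta) * q n z + theta * q n.+1 z) ^+ 2.
  have [[Qu Qq] [Qu' Qq']] := (Q n, Q n.+1).
  have QU : Qh m k (theta_avg theta u n) by exact: Qlin.
  have QP : Qh m k (theta_avg theta q n) by exact: Qlin.
  have /= := scheme_u n _ QU.
  (* With the [u] average in first position, [A] splits over [u n] and [u n.+1]; the second equation
     at both levels, tested with the [q] average, then recombines into the squared norm of that
     average. *)
  rewrite AC A_lin; last 3 first.
  - exact: Qh_cellwise Qu.
  - exact: Qh_cellwise Qu'.
  - exact: Qh_cellwise QP.
  rewrite -!scheme_q// -L2inner_lin; do ?by [case: Qq|case: Qq'|case: QP].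
  rewrite -[L2inner m _ (theta_avg theta q n)]sqr_L2norm; last by case: QP.
  set P := L2norm m _ ^+ 2.
  (* The difference quotient is put in the shape that [L2inner_lin] expects. *)
  rewrite (_ : (fun z => (u n.+1 z - u n z) / dt) =
    fun z => dt^-1 * u n.+1 z + (- dt^-1) * u n z); last first.
    by apply/funext => z; ring.
  case: Qu => u2 _; case: Qu' => u2' _; case: (QU) => U2 _.
  rewrite L2inner_lin// ![L2inner m _ (theta_avg _ _ _)]L2innerC /theta_avg.
  rewrite !L2inner_lin// [L2inner m (u n) (u n.+1)]L2innerC !sqr_L2norm//.
  (* The squared norm of the increment, with coefficients 1 and -1 so that [L2inner_lin] expands it;
     it becomes [X - 2 * Y + Z] below. *)
  have : 0 <= L2inner m (fun z => 1 * u n.+1 z + -1 * u n z)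
                        (fun z => 1 * u n.+1 z + -1 * u n z).
    exact: L2inner_ge0.
  rewrite L2inner_lin//; last exact: inL2_lin.
  rewrite ![L2inner m _ (fun z => 1 * _ + _)]L2innerC !L2inner_lin//.
  rewrite [L2inner m (u n) (u n.+1)]L2innerC.
  set X := L2inner m (u n.+1) (u n.+1); set Y := L2inner m (u n.+1) (u n).
  set Z := L2inner m (u n) (u n) => D0 E.
  (* The equation [E] times [dt]: the bracket is the inner product of the increment with the [u]
     average. *)
  have PE : dt * P = - ((X - Y) * theta + (Y - Z) * (1 - theta)).
    by rewrite -[P]opprK -E; field; rewrite gt_eqF.
  (* Here [1 / 2 <= theta] enters. Twice this product is exactly the gap between the two sides of
     the energy inequality. *)
  have : 0 <= (theta - 1 / 2) * (X - 2 * Y + Z).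
    apply: mulr_ge0; first by rewrite subr_ge0; case/andP: htheta.
    by apply: le_trans D0 _; lra.
  rewrite -/P -mulrA PE; lra.
split=> [n|]; last exact: step.
(* Dropping the nonnegative dissipation term makes the squared norms non-increasing in [n], hence
   also the norms, which are nonnegative. *)
elim: n => [//|n IH]; apply: (le_trans _ IH).
rewrite -(@ler_pXn2r _ 2) ?nnegrE ?L2norm_ge0//.
apply: (le_trans (step n)).
by rewrite gerBl mulr_ge0 ?sqr_ge0// mulr_ge0 ?ltW.
Qed.
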